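(* For every integer $k\ge 4$ there exist a finite connected graph $G$ and a non-edge $e\notin E(G)$ (a pair of distinct nonadjacent vertices of $G$) such that $\beta(G)\le k$ but $\beta(G+e)\ge (k+1)2^{k-2}-1$. Hence $\iota(d)=\Omega(d\,2^d)$ as $d\to\infty$.
   Context: Graphs are simple. For a connected graph $G$, $d(u,v)$ is the number of edges of a shortest $u$--$v$ path. A vertex $w$ resolves $u,v$ if $d(u,w)\ne d(v,w)$; a set $W\subseteq V(G)$ is a resolving set if every two distinct vertices of $G$ are resolved by some $w\in W$. The metric dimension $\beta(G)$ is the minimum cardinality of a resolving set. $G+e$ is $G$ with the edge $e$ added. For a positive integer $d$, $\iota(d)=\sup\{\beta(G+e): G \text{ a finite connected graph},\ \beta(G)=d,\ e\notin E(G)\}$, with value in $\mathbb{N}\cup\{\infty\}$. The statement $\iota(d)=\Omega(d2^d)$ means that there are $c>0$ and $d_0$ such that $\iota(d)\ge c\,d\,2^d$ for all $d\ge d_0$. *)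

(* Defs.v *)
From mathcomp Require Import all_boot all_order all_algebra.
From mathcomp Require Import all_classical all_reals ereal.

Set Implicit Arguments.
Unset Strict Implicit.
Unset Printing Implicit Defensive.

Import Order.TTheory GRing.Theory Num.Theory.

Record sgraph := SGraph {
  vertex :> finType;
  edge : rel vertex;
  edge_sym : symmetric edge;
  edge_irr : irreflexive edge }.

Definition connected_graph (G : sgraph) : bool :=
  (0 < #|G|) && [forall u : G, forall v : G, connect (@edge G) u v].

(* [p] is the list of the vertices after [u] on the path, so that its size is
   the number of edges. *)
Definition has_upath (G : sgraph) (u v : G) (n : nat) : bool :=
  [exists p : n.-tuple G,
     [&& path (@edge G) u p, uniq (u :: p) & last u p == v]].

(* A path has fewer than [#|G|] edges; the value is the junk [#|G|] when there
   is no path from [u] to [v]. *)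
Definition dist (G : sgraph) (u v : G) : nat :=
  find (has_upath u v) (iota 0 #|G|).

Definition resolves (G : sgraph) (w u v : G) : bool := dist u w != dist v w.

Definition resolving (G : sgraph) (W : {set G}) : bool :=
  [forall u : G, forall v : G,
     (u != v) ==> [exists w in W, resolves w u v]].

(* The default [setT] of the arg min is itself resolving. *)
Definition metric_dim (G : sgraph) : nat :=
  #|[arg min_(W < [set: G] | resolving W) #|W| ]|.

Section AddEdge.
Variables (G : sgraph) (x y : G).

Definition add_edge_rel : rel G :=
  fun u v => edge u v || (u != v) && ([set u; v] == [set x; y]).

Lemma add_edge_sym : symmetric add_edge_rel.
Proof. by move=> u v; rewrite /add_edge_rel edge_sym eq_sym finset.setUC. Qed.

Lemma add_edge_irr : irreflexive add_edge_rel.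
Proof. by move=> u; rewrite /add_edge_rel edge_irr eqxx. Qed.

(* This is [G] itself when [x = y]. *)
Definition add_edge : sgraph := SGraph add_edge_sym add_edge_irr.

End AddEdge.

Definition non_edge (G : sgraph) (x y : G) : bool := (x != y) && ~~ edge x y.

(* The supremum is taken in the extended reals; for [0 < d] the set is nonempty,
   so that the value is a natural number or [+oo]. *)
Definition iota_dim (R : realType) (d : nat) : \bar R :=
  ereal_sup [set z : \bar R |
    exists (G : sgraph) (x y : G),
      [/\ connected_graph G, metric_dim G = d, non_edge x y
        & z = ((metric_dim (add_edge x y))%:R%R)%:E] ]%classic.

(* Main.v *)
(** The graph [gadget_graph n] has one gadget [U P], [V P], [M P] for every pattern
    [P : 'I_n -> {0, 1, 2}], and [n.+1] pairs of twins, [T _] and [S i _].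
    One vertex of each pair is needed, and these suffice: the distance from
    [S i _] reads off [P i], and the distance from [T _] separates [U P], [V P] and
    [M P], because [T _] lies behind the hub [B], which reaches [U P] through [M P]
    only, while [V P] hangs on the hub [A].  Once [A] and [B] are adjacent, a walk
    [U P, M P, B] can be traded for [V P, A, B], so that only the gadget itself
    resolves [U P] from [V P]; a resolving set then meets all [3 ^ n] gadgets. *)

Require Import Defs.
From HB Require Import structures.
From mathcomp Require Import all_boot all_order all_algebra.
From mathcomp Require Import all_classical all_reals ereal.
From mathcomp Require Import zify ring.

Set Implicit Arguments.
Unset Strict Implicit.
Unset Printing Implicit Defensive.

Import Order.TTheory GRing.Theory Num.Theory.

(** Since [h] gives each vertex at most one label, a set hitting every label has at least [#|I|]
    elements. Both lower bounds on metric dimension come from this, with twin pairs and then gadgets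
    as labels. *)
Lemma leq_card_cover (T I : finType) (h : T -> option I) (W : {set T}) :
  (forall i, exists2 x, x \in W & h x = Some i) -> #|I| <= #|W|.
Proof.
move=> hW; have <- : #|[set Some i | i in [set: I]]| = #|I|.
  by rewrite card_imset ?cardsT // => i j [].
apply: leq_trans (leq_imset_card h W); apply/subset_leq_card/fintype.subsetP => o.
by case/imsetP=> i _ ->; have [x xW hx] := hW i; apply/imsetP; exists x.
Qed.

(** * Walks, distances and resolving sets *)

Section Distance.
Variable G : sgraph.
Implicit Types (u v w : G) (p : seq G) (f : G -> nat) (W : {set G}).

Lemma dist_le_walk u v p :
  path (@edge G) u p -> last u p = v -> dist u v <= size p.
Proof.
move=> up pv; case/shortenP: up pv => q uq Uq qp qv.
(* A duplicate-free path has fewer than [#|G|] edges, so its length lies in the range that [find]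
   searches. *)
have sq : size q < #|G| by have := max_card [in u :: q]; rewrite (card_uniqP Uq).
apply: leq_trans (uniq_leq_size _ qp); last by case/andP: Uq.
rewrite leqNgt; apply/negP => /(before_find 0).
rewrite nth_iota // add0n => /existsP; apply; exists (in_tuple q).
by rewrite uq Uq qv eqxx.
Qed.

Lemma dist_ltn_card u v p :
  path (@edge G) u p -> last u p = v -> dist u v < #|G|.
Proof.
move=> up pv; case/shortenP: up pv => q uq Uq _ qv.
apply: leq_ltn_trans (dist_le_walk uq qv) _.
by have := max_card [in u :: q]; rewrite (card_uniqP Uq).
Qed.

Lemma dist_leq_card u v : dist u v <= #|G|.
Proof. by rewrite -[leqRHS](size_iota 0) find_size. Qed.

Lemma dist_walk u v : dist u v < #|G| ->
  exists p, [/\ path (@edge G) u p, last u p = v & size p = dist u v].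
Proof.
move=> lt_uv; have : has (has_upath u v) (iota 0 #|G|) by rewrite has_find size_iota.
move=> /(nth_find 0); rewrite nth_iota // add0n => /existsP[p /and3P[up _ /eqP pv]].
by exists p; rewrite size_tuple.
Qed.

(** Walk-by-walk comparison suffices: if [w] is unreachable from [u], the default value [#|G|]
    bounds [dist v w'] anyway. *)
Lemma leq_dist u v w w' :
  (forall p, path (@edge G) u p -> last u p = w ->
   exists q, [/\ path (@edge G) v q, last v q = w' & size q <= size p]) ->
  dist v w' <= dist u w.
Proof.
move=> uv; have := dist_leq_card u w; rewrite leq_eqVlt.
case/predU1P=> [->|/dist_walk[p [up pw <-]]]; first exact: dist_leq_card.
by have [q [vq qw /(leq_trans _)->]] := uv p up pw; rewrite ?dist_le_walk.
Qed.

Lemma dist_sym u v : dist u v = dist v u.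
Proof.
suff le u' v' : dist u' v' <= dist v' u' by apply/eqP; rewrite eqn_leq !le.
apply: leq_dist => p vp pu; exists (rev (belast v' p)).
rewrite size_rev size_belast -{1}pu rev_path; split=> //.
- by rewrite (eq_path (e' := @edge G)) // => x y; rewrite edge_sym.
- by case: p vp pu => [|x p] _ /= => [->|_] //; rewrite rev_cons last_rcons.
Qed.

Lemma distxx u : dist u u = 0.
Proof. by apply/eqP; rewrite -leqn0; apply: (@dist_le_walk u u [::]). Qed.

Lemma dist_eq0 u v : dist u v = 0 -> u = v.
Proof.
move=> uv0; have lt_uv : dist u v < #|G| by rewrite uv0; apply/card_gt0P; exists u.
by have [[|x p] [_ pv]] := dist_walk lt_uv; rewrite uv0.
Qed.

Lemma resolving_setT : resolving [set: G].
Proof.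
apply/forallP=> u; apply/forallP=> v; apply/implyP=> uv.
apply/existsP; exists u; rewrite finset.in_setT /resolves distxx eq_sym.
by apply: contra uv => /eqP/dist_eq0->.
Qed.

Lemma metric_dim_le W : resolving W -> metric_dim G <= #|W|.
Proof.
by rewrite /metric_dim; case: arg_minnP => [|W' _ W'min /W'min //]; apply: resolving_setT.
Qed.

Lemma metric_dim_ge m :
  (forall W, resolving W -> m <= #|W|) -> m <= metric_dim G.
Proof.
by rewrite /metric_dim; case: arg_minnP => [|W' rW' _ ->//]; apply: resolving_setT.
Qed.

Lemma resolvingP W :
  reflect (forall u v, u != v -> exists2 w, w \in W & dist u w != dist v w)
    (resolving W).
Proof.
apply: (iffP forallP) => [rW u v uv | rW u].
  by have /forallP/(_ v)/implyP/(_ uv)/exists_inP := rW u.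
by apply/forallP=> v; apply/implyP=> /rW ?; apply/exists_inP.
Qed.

(** * Certifying distances by a potential *)

Section Potential.
Variables (f : G -> nat) (w : G).
Hypothesis f0 : f w = 0.
Hypothesis f_edge : forall x y, edge x y -> f x <= (f y).+1.
Hypothesis f_desc : forall x, x != w -> exists2 y, edge x y & f x = (f y).+1.

Lemma potential_walk x :
  exists p, [/\ path (@edge G) x p, last x p = w & size p = f x].
Proof.
have [m] := ubnP (f x); elim: m x => // m IH x; rewrite ltnS => fx.
have [->|/f_desc[y xy fxy]] := eqVneq x w; first by exists [::].
by have [|p [yp pw sp]] := IH y; [rewrite -fxy | exists (y :: p); rewrite /= xy yp sp].
Qed.

(** By [f_edge] the potential drops by at most one per edge, so no walk to [w] is shorter than
    [f x]; following [f_desc] yields a walk of exactly that length. *)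
Lemma potential_dist x : dist x w = f x.
Proof.
have [p [xp pw sp]] := potential_walk x.
have f_walk q y : path (@edge G) y q -> last y q = w -> f y <= size q.
  elim: q y => [|z q IH] y /= => [_ ->|/andP[yz zq] qw]; first by rewrite f0.
  by apply: leq_trans (f_edge yz) _; rewrite ltnS IH.
have le_d : dist x w <= f x by rewrite -sp dist_le_walk.
have [q [xq qw sq]] := dist_walk (dist_ltn_card xp pw).
by apply/eqP; rewrite eqn_leq le_d -sq f_walk.
Qed.

Lemma potential_connected : connected_graph G.
Proof.
have to_w x : connect (@edge G) x w.
  by have [p [xp pw _]] := potential_walk x; apply/connectP; exists p.
rewrite /connected_graph; apply/andP; split; first by apply/card_gt0P; exists w.
apply/forallP=> x; apply/forallP=> y; apply: connect_trans (to_w x) _.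
by rewrite (sym_connect_sym (@edge_sym G)) to_w.
Qed.

End Potential.
End Distance.

(** * The gadget graph and its distances *)

Notation pattern n := {ffun 'I_n -> 'I_3}.

Inductive gvertex (n : nat) :=
| A | B | T of bool | Z of 'I_n | W of 'I_n | S of 'I_n & bool
| U of pattern n | V of pattern n | M of pattern n.
Arguments A {n}.
Arguments B {n}.
Arguments T {n}.

Definition gvertex_code n (x : gvertex n) :
    bool + bool + ('I_n * option (option bool)) + (pattern n * option bool) :=
  match x with
  | A => inl (inl (inl true))
  | B => inl (inl (inl false))
  | T b => inl (inl (inr b))
  | Z i => inl (inr (i, None))
  | W i => inl (inr (i, Some None))
  | S i b => inl (inr (i, Some (Some b)))
  | U P => inr (P, None)
  | V P => inr (P, Some true)
  | M P => inr (P, Some false)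
  end.

Definition gvertex_decode n (c : bool + bool + ('I_n * option (option bool)) +
    (pattern n * option bool)) : gvertex n :=
  match c with
  | inl (inl (inl true)) => A
  | inl (inl (inl false)) => B
  | inl (inl (inr b)) => T b
  | inl (inr (i, None)) => Z i
  | inl (inr (i, Some None)) => W i
  | inl (inr (i, Some (Some b))) => S i b
  | inr (P, None) => U P
  | inr (P, Some true) => V P
  | inr (P, Some false) => M P
  end.

Lemma gvertex_codeK n : cancel (@gvertex_code n) (@gvertex_decode n).
Proof. by case. Qed.

HB.instance Definition _ n := Finite.copy (gvertex n) (can_type (@gvertex_codeK n)).

Section Gadgets.
Variable n : nat.
Implicit Types (x y : gvertex n) (i j : 'I_n) (b c : bool) (P Q : pattern n).

(* [Z i] and [W i] put [U P] and [V P] at distance [P i + 2] from [S i _]: the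
   path goes through [Z i] if [P i = 0], through [W i] and [Z i] if [P i = 1],
   and otherwise through [A], another gadget and [Z i]. *)
Definition garc x y : bool :=
  match x, y with
  | A, (U _ | V _) | B, (M _ | T _) => true
  | T b, T c => b != c
  | M P, U Q => P == Q
  | Z i, (U P | V P) => P i == 0 :> nat
  | W i, (U P | V P) => P i == 1 :> nat
  | Z i, (W j | S j _) => i == j
  | S i b, S j c => (i == j) && (b != c)
  | _, _ => false
  end.

Definition gedge : rel (gvertex n) := fun x y => garc x y || garc y x.

Lemma gedge_sym : symmetric gedge.
Proof. by move=> x y; apply: orbC. Qed.

Lemma gedge_irr : irreflexive gedge.
Proof. by case=> //= *; rewrite /gedge /= ?eqxx ?andbF. Qed.

Definition gadget_graph : sgraph := SGraph gedge_sym gedge_irr.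
Local Notation G := gadget_graph.

(** Closed form of the distance to [T b]. The value 5 at [V P] comes from the detour [V P], [A],
    [U Q], [M Q], [B], [T b]. *)
Definition distT b x : nat :=
  match x with
  | T c => c != b
  | B => 1
  | M _ => 2
  | U _ => 3
  | A | Z _ | W _ => 4
  | V _ | S _ _ => 5
  end.

Definition distS i b x : nat :=
  match x with
  | S j c => if j == i then (c != b : nat) else 4
  | Z j => if j == i then 1 else 3
  | W j => if j == i then 2 else 3
  | U P | V P => P i + 2
  | A => 3
  | M P => P i + 3
  | B => 4
  | T _ => 5
  end.

Lemma leq_edge (f : G -> nat) :
  (forall x y, garc x y -> f x <= (f y).+1 /\ f y <= (f x).+1) ->
  forall x y : G, edge x y -> f x <= (f y).+1.
Proof. by move=> lip x y /orP[] /lip[]. Qed.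

Lemma distT_edge b (x y : G) : edge x y -> distT b x <= (distT b y).+1.
Proof.
move: x y; apply: leq_edge => -[||c|?|?|??|?|?|?] [||c'|?|?|??|?|?|?] //= _; lia.
Qed.

Lemma distT_desc b (x : G) :
  x != T b -> exists2 y : G, edge x y & distT b x = (distT b y).+1.
Proof.
case: x => [||c|i|i|i c|P|P|P] xT /=.
- by exists (U [ffun=> ord0]).
- by exists (T b) => //=; rewrite eqxx.
- have cb : c != b by apply: contra xT => /eqP->.
  by exists (T b); rewrite /= ?/gedge /= cb ?eqxx.
- by exists (U [ffun=> ord0]); rewrite //= /gedge /= ffunE.
- by exists (U [ffun=> inord 1]); rewrite //= /gedge /= ffunE inordK.
- by exists (Z i); rewrite //= /gedge /= eqxx.
- by exists (M P); rewrite //= /gedge /= eqxx.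
- by exists A.
- by exists B.
Qed.

Lemma distS_edge i b (x y : G) : edge x y -> distS i b x <= (distS i b y).+1.
Proof.
(* The edges from [A] to [U P] and from [B] to [M P] need [P i <= 2]. *)
have lt3 P : P i < 3 by [].
move: x y; apply: leq_edge => -[||c|j|j|j c|P|P|P] [||c'|j'|j'|j' c'|Q|Q|Q] //=;
  do ?[move/eqP<-|case/andP=> /eqP<- _]; try (have := lt3 P); try (have := lt3 Q);
  by try (case: (eqVneq j i) => [ji|_]; rewrite ?ji); lia.
Qed.

Lemma distS_desc i b (x : G) :
  x != S i b -> exists2 y : G, edge x y & distS i b x = (distS i b y).+1.
Proof.
(* [U P] and [V P] have a common neighbour one step closer to [S i b], chosen by the value of
   [P i]. *)
have step P : exists h : G,
    [/\ gedge (U P) h, gedge (V P) h & P i + 2 = (distS i b h).+1].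
  have := ltn_ord (P i); case Pi: (P i : nat) => [|[|[]]] //= _.
  - by exists (Z i); rewrite /gedge /= Pi !eqxx.
  - by exists (W i); rewrite /gedge /= Pi !eqxx.
  - by exists A.
case: x => [||c|j|j|j c|P|P|P] xS /=.
- by exists (U [ffun=> ord0]); rewrite //= ffunE.
- by exists (M [ffun=> ord0]); rewrite //= ffunE.
- by exists B.
- case: eqVneq => [->|_]; first by exists (S i b); rewrite //= /gedge /= !eqxx.
  by exists (U [ffun=> ord0]); rewrite //= /gedge /= ffunE.
- case: eqVneq => [->|ji]; first by exists (Z i); rewrite //= /gedge /= eqxx.
  (* The value 1 at [j] makes this gadget adjacent to [W j]; the value 0 at [i] puts it at distance
     2 from [S i b]. *)
  exists (U [ffun k => if k == j then inord 1 else ord0]).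
    by rewrite /= /gedge /= ffunE eqxx inordK.
  by rewrite /= ffunE eq_sym (negPf ji).
- case: (eqVneq j i) xS => [->|ji] xS; last first.
    by exists (Z j); rewrite /= /gedge /= ?eqxx // (negPf ji).
  have cb : c != b by apply: contra xS => /eqP->.
  by exists (S i b); rewrite /= ?/gedge /= cb ?eqxx.
- by have [h [Uh _ fh]] := step P; exists h.
- by have [h [_ Vh fh]] := step P; exists h.
- by exists (U P); rewrite //= /gedge /= ?eqxx // addnS.
Qed.

(** * Metric dimension of the gadget graph *)

Lemma dist_T b (x : G) : dist x (T b : G) = distT b x.
Proof.
by apply: potential_dist; [rewrite /= eqxx | apply: distT_edge | apply: distT_desc].
Qed.

Lemma dist_S i b (x : G) : dist x (S i b : G) = distS i b x.
Proof.
by apply: potential_dist; [rewrite /= !eqxx | apply: distS_edge | apply: distS_desc].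
Qed.

Lemma gadget_graph_connected : connected_graph G.
Proof.
apply: (@potential_connected G (distT true) (T true)) => //.
exact: distT_desc.
Qed.

(** Equal [distT] leaves, across constructors, only the classes [B], [T true]; [A], [Z], [W]; and
    [V], [S]. Any index separates the first, whence [0 < n]; in the others, index [j] isolates
    [Z j], [W j] and each [S j _]. Within [U], [V] or [M], the distances spell out the pattern. *)
Lemma landmarks_inj (x y : G) : 0 < n -> distT false x = distT false y ->
  (forall i, distS i false x = distS i false y) -> x = y.
Proof.
move=> n0.
have eq_pat k P Q : (forall i, P i + k = Q i + k) -> P = Q.
  by move=> PQ; apply/ffunP=> i; apply/val_inj/(@addIn k)/PQ.
case: x y => [||[|]|j|j|j [|]|P|P|P] [||[|]|j'|j'|j' [|]|Q|Q|Q] //= _ xy;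
  first [ by have := xy (Ordinal n0)
        | by have := xy j'; rewrite eqxx ?addn2 //; case: eqVneq => [->|]
        | by have := xy j; rewrite eqxx ?addn2
        | by rewrite (eq_pat _ _ _ xy) ].
Qed.

Definition landmarks : {set G} :=
  (T false : G) |: [set (S i false : G) | i : 'I_n].

Lemma landmarks_resolving : 0 < n -> resolving landmarks.
Proof.
move=> n0; apply/resolvingP=> x y xy.
have [Txy|Txy] := eqVneq (distT false x) (distT false y); last first.
  by exists (T false); rewrite ?dist_T // !inE eqxx.
have [i Sxy] : exists i, distS i false x != distS i false y.
  apply/existsP; apply: contraR xy => /existsPn Sxy.
  by apply/eqP/landmarks_inj => // i; apply/eqP/negbNE/Sxy.
by exists (S i false); rewrite ?dist_S // !inE imset_f ?orbT.
Qed.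

Lemma gadget_graph_dim : 0 < n -> metric_dim G = n.+1.
Proof.
move=> n0; apply/eqP; rewrite eqn_leq; apply/andP; split.
  apply: leq_trans (metric_dim_le (landmarks_resolving n0)) _.
  rewrite cardsU1 -add1n leq_add ?leq_b1 //.
  by apply: leq_trans (leq_imset_card _ _) _; rewrite card_ord.
(* Twins are equidistant from every vertex outside their pair, so [W] meets all [n.+1] pairs;
   [Some None] labels the pair [T _]. *)
apply: metric_dim_ge => W /resolvingP rW.
pose h (x : G) :=
  match x with T _ => Some None | S i _ => Some (Some i) | _ => None end.
rewrite -[n in n.+1]card_ord -card_option; apply: (@leq_card_cover _ _ h) => -[i|].
  have [|w wW] := rW (S i false) (S i true); first by apply/eqP=> -[].
  rewrite !(dist_sym _ w) !dist_S => neq; exists w => //.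
  case: w neq {wW} => [||c|j|j|j c|P|P|P] /=;
    by rewrite ?eqxx //; case: (eqVneq j i) => [->|]; rewrite ?eqxx.
have [//|w wW] := rW (T false) (T true).
by rewrite !(dist_sym _ w) !dist_T => neq; exists w => //; case: w neq {wW}.
Qed.

(** * The graph after joining [A] and [B] *)

Local Notation G' := (@add_edge G A B).

Lemma add_edge_AB : @edge G' A B.
Proof. by rewrite /= /add_edge_rel eqxx andbT orbT. Qed.

Lemma edge_add_edge (x y : G) : edge x y -> @edge G' x y.
Proof. by move=> xy; apply/orP; left. Qed.

Lemma add_edge_off (x y : G) : x != A -> x != B -> @edge G' x y -> edge x y.
Proof.
move=> xA xB; rewrite /= /add_edge_rel [_ == [set A; B]]negbTE ?andbF ?orbF //.
apply/eqP => /setP/(_ x).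
by rewrite !inE eqxx (negPf xA) (negPf xB).
Qed.

Lemma dist_VU P (w : G') :
  w != U P -> w != V P -> w != M P -> dist (V P : G') w = dist (U P : G') w.
Proof.
move=> wU wV wM; apply/eqP; rewrite eqn_leq; apply/andP; split; apply: leq_dist.
  (* Strong induction on length: a walk from [U P] may return to [U P] through [M P], and that
     excursion is cut off. *)
  move=> p; have [m] := ubnP (size p); elim: m p => // m IH [|x p] /=.
    by move=> _ _ Uw; rewrite -Uw eqxx in wU.
  rewrite ltnS => pm /andP[Ux xp] xw; have {}Ux := @add_edge_off (U P) x isT isT Ux.
  (* [M P] is the only neighbour of [U P] that is not adjacent to [V P]. *)
  have [xM|xM] := eqVneq x (M P); last first.
    exists (x :: p); split=> //=; rewrite xp andbT; apply: edge_add_edge.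
    case: x Ux xM {xp xw} => [||c|j|j|j c|Q|Q|Q] //=.
    by rewrite /gedge /= => /eqP->; rewrite eqxx.
  rewrite {}xM in xp xw.
  case: p pm xp xw => [_ _ Mw|y p /= pm /andP[My yp] yw]; first by rewrite -Mw eqxx in wM.
  have {}My := @add_edge_off (M P) y isT isT My.
  case: y My yp yw => [||c|j|j|j c|Q|Q|Q] //=; rewrite /gedge //= ?orbF.
    (* The new edge enters here: [A], [B] replaces [M P], [B] at equal length. *)
    move=> _ Bp Bw; exists [:: A, B & p]; split=> //=.
    by rewrite Bp andbT; apply: add_edge_AB.
  move=> /eqP<- Up Uw; have [|q [Vq qw qp]] := IH p _ Up Uw; first exact: ltnW.
  by exists q; split=> //; apply: leq_trans qp _; rewrite ltnW.
(* Conversely, every neighbour of [V P] is adjacent to [U P], so only the first vertex changes. *)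
move=> [|x p] /=; first by move=> _ Vw; rewrite -Vw eqxx in wV.
move=> /andP[Vx xp] xw; exists (x :: p); split=> //=; rewrite xp andbT.
have {}Vx := @add_edge_off (V P) x isT isT Vx; apply: edge_add_edge.
by case: x Vx {xp xw}.
Qed.

Lemma add_edge_dim : 3 ^ n <= metric_dim G'.
Proof.
apply: metric_dim_ge => W /resolvingP rW.
pose h (x : G) := match x with U P | V P | M P => Some P | _ => None end.
rewrite -[3]card_ord -[n in _ ^ n]card_ord -card_ffun.
apply: (@leq_card_cover _ _ h) => P.
have [|w wW] := rW (U P) (V P); first by apply/eqP=> -[].
have [wU|wU] := eqVneq w (U P); first by exists w; rewrite // wU.
have [wV|wV] := eqVneq w (V P); first by exists w; rewrite // wV.
have [wM|wM] := eqVneq w (M P); first by exists w; rewrite // wM.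
by rewrite dist_VU ?eqxx.
Qed.

End Gadgets.

(** * Numerical estimates and conclusion *)

Lemma leq_dim_bound k : 4 <= k -> (k + 1) * 2 ^ (k - 2) - 1 <= 3 ^ k.-1.
Proof.
case: k => [|[|[|[|k]]]] // _.
have -> : k.+4.-1 = k + 3 by lia.
have -> : k.+4 - 2 = k + 2 by lia.
(* The base case is 19 <= 27; each step multiplies the left product by at most 12/5 and the right
   side by 3. *)
rewrite !expnD; elim: k => // k; rewrite !expnS.
have := expn_gt0 2 k; have := expn_gt0 3 k; nia.
Qed.

Theorem theorem4p4 (R : realType) :
  (forall k : nat, (4 <= k)%N ->
     exists (G : sgraph) (x y : G),
       [/\ connected_graph G, non_edge x y, (metric_dim G <= k)%N
         & ((k + 1) * 2 ^ (k - 2) - 1 <= metric_dim (add_edge x y))%N])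
  /\
  (exists (c : R) (d0 : nat), (0 < c)%R /\
     forall d : nat, (d0 <= d)%N ->
       ((c * d%:R * 2 ^+ d)%R%:E <= iota_dim R d)%E).
Proof.
have dim k : 4 <= k -> metric_dim (gadget_graph k.-1) = k /\
    (k + 1) * 2 ^ (k - 2) - 1 <= metric_dim (@add_edge (gadget_graph k.-1) A B).
  move=> k4; split; first by rewrite gadget_graph_dim; lia.
  exact: leq_trans (leq_dim_bound k4) (add_edge_dim _).
split=> [k /dim[dimG dimG']|].
  exists (gadget_graph k.-1), A, B; split=> //; last by rewrite dimG.
  exact: gadget_graph_connected.
(* The constant 1/4 turns [2 ^ d] into [2 ^ (d - 2)]. *)
exists (4%:R^-1)%R, 4; split; first by rewrite invr_gt0.
move=> d d4; have [dimG dimG'] := dim d d4.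
apply: le_trans (ereal_sup_ubound _); last first.
  exists (gadget_graph d.-1), A, B; split=> //.
  exact: gadget_graph_connected.
rewrite lee_fin.
have : d * 2 ^ (d - 2) <= metric_dim (@add_edge (gadget_graph d.-1) A B).
  (* The extra summand [2 ^ (d - 2)] is at least 1 and absorbs the subtracted 1. *)
  apply: leq_trans dimG'; have := expn_gt0 2 (d - 2); lia.
rewrite -(ler_nat R); apply: le_trans; rewrite natrM natrX.
have -> : (2 ^+ d = 4 * 2 ^+ (d - 2) :> R)%R.
  by rewrite -[in LHS](subnKC (ltnW (ltnW d4))) exprD -natrX.
by rewrite le_eqVlt; apply/orP; left; apply/eqP; field.
Qed.
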